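(* Let $G$ be a finite simple graph with no connected component isomorphic to $K_2$. If $\delta(G)\ge 8\chi(G)$, where $\delta(G)$ is the minimum degree and $\chi(G)$ the chromatic number of $G$, then $G$ admits a vertex-coloring $2$-edge-weighting.
   Context: A $k$-edge-weighting of $G$ is a map $w:E(G)\to\{1,\dots,k\}$; it induces the vertex coloring $c(u)=\sum_{e\ni u} w(e)$ for $u\in V(G)$. The edge-weighting is vertex-coloring if $c(u)\ne c(v)$ for every edge $uv\in E(G)$. *)

(* Defs.v *)
From mathcomp Require Import all_boot.
Set Implicit Arguments.
Unset Strict Implicit.
Unset Printing Implicit Defensive.

Record sgraph := SGraph {
  vertex :> finType;
  adj : rel vertex;
  adj_sym : symmetric adj;
  adj_irrefl : irreflexive adj }.

Definition edges (G : sgraph) : {set {set G}} :=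
  [set [set p.1; p.2] | p in [set p : G * G | adj p.1 p.2]].

Definition degree (G : sgraph) (u : G) : nat := #|[set v | adj u v]|.

(* Every degree is smaller than #|G|, so the seed #|G| is irrelevant unless G  *)
(* has no vertex, in which case the value is 0.                                *)
Definition min_degree (G : sgraph) : nat := \big[minn/#|G|]_(u : G) degree u.

Definition proper_coloring (G : sgraph) (C : eqType) (f : G -> C) : bool :=
  [forall u : G, forall v : G, adj u v ==> (f u != f v)].

Definition colorable (G : sgraph) (k : nat) : bool :=
  [exists f : {ffun G -> 'I_k}, proper_coloring f].

Lemma ex_colorable (G : sgraph) : exists k, colorable G k.
Proof.
exists #|G|; apply/existsP; exists [ffun u => enum_rank u].
apply/forallP=> u; apply/forallP=> v; apply/implyP=> uv; rewrite !ffunE.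
by apply: contraTneq uv => /enum_rank_inj ->; rewrite adj_irrefl.
Qed.

Definition chromatic_number (G : sgraph) : nat := ex_minn (ex_colorable G).

Section Induced.
Variables (G : sgraph) (A : {set G}).

Definition induced_adj : rel {x : G | x \in A} :=
  fun x y => adj (val x) (val y).

Lemma induced_adj_sym : symmetric induced_adj.
Proof. by move=> x y; apply: adj_sym. Qed.

Lemma induced_adj_irrefl : irreflexive induced_adj.
Proof. by move=> x; apply: adj_irrefl. Qed.

Definition induced : sgraph := SGraph induced_adj_sym induced_adj_irrefl.
End Induced.

Section Complete.
Variable n : nat.

Definition complete_adj : rel 'I_n := fun i j => i != j.

Lemma complete_adj_sym : symmetric complete_adj.
Proof. by move=> i j; apply: (congr1 negb (eq_sym i j)). Qed.

Lemma complete_adj_irrefl : irreflexive complete_adj.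
Proof. by move=> i; apply: (congr1 negb (eqxx i)). Qed.

Definition complete : sgraph := SGraph complete_adj_sym complete_adj_irrefl.
End Complete.

Definition graph_iso (G H : sgraph) : Prop :=
  exists2 f : G -> H, bijective f & {mono f : x y / adj x y}.

Definition component (G : sgraph) (x : G) : {set G} :=
  [set y | connect (@adj G) x y].

(* A weighting is a function on all vertex sets of which only the values on    *)
(* edges matter.                                                               *)
Definition edge_weighting (G : sgraph) (k : nat) (w : {set G} -> nat) : Prop :=
  forall e : {set G}, e \in edges G -> 1 <= w e <= k.

Definition weight_coloring (G : sgraph) (w : {set G} -> nat) (u : G) : nat :=
  \sum_(e in edges G | u \in e) w e.

Definition vertex_coloring_weighting (G : sgraph) (w : {set G} -> nat) : Prop :=
  forall u v : G, adj u v -> weight_coloring w u <> weight_coloring w v.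

(* Main.v *)
(**
  Fix a proper coloring [f] with [k] colors. It suffices to find a spanning
  subgraph [h] with [deg v + deg_h v] congruent to [2 f v] or [2 f v + 1] modulo
  [2 k] at every [v], and to give weight 2 to the edges of [h] and weight 1 to
  the others. Choosing [lo v] in the right residue class just below [deg v / 2]
  and [hi v = lo v + 2 k], such an [h] is provided by a theorem of Addario-Berry,
  Dalal and Reed: under mild bounds on [lo] and [hi] (this is where [8 k] comes
  from) some spanning subgraph has all its degrees in
  [{lo, lo + 1, hi, hi + 1}].

  To prove the latter, choose a target in [{lo, hi}] at each vertex and a
  subgraph exceeding no target by more than 1, with the least total deficit.
  From a deficient vertex [x] explore alternating paths. The slack of 1 in the
  degrees separates the reached vertices into those above their target ([B])
  and the others ([A]), as otherwise an alternating path can be augmented. A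
  vertex of [A] aiming at [hi] with many neighbors in [B] can be switched to
  [lo], a vertex of [B] aiming at [lo] with many neighbors in [A] can be
  switched to [hi], and either switch helps [x]. When neither is possible,
  counting the edges between [A] and [B] gives a contradiction.
*)
Require Import Defs.
From mathcomp Require Import all_boot.
From mathcomp Require Import zify.

(** * Spanning subgraphs, star toggling and alternating paths *)

Section Subgraphs.
Set Implicit Arguments.
Unset Strict Implicit.

Variable G : sgraph.
Implicit Types (h : rel G) (u v w x y : G) (S : {set G}) (p : seq G).

Definition subgraph_deg h v := #|[set w | h v w]|.

Definition spanning h := symmetric h /\ subrel h (@adj G).

Definition toggle_star v S h : rel G := fun u w =>
  h u w (+) ((u == v) && (w \in S) || (w == v) && (u \in S)).

Lemma card_toggle (N S : {set G}) (b : bool) :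
  (forall w, w \in S -> (w \in N) = b) ->
  #|[set w | (w \in N) (+) (w \in S)]| + b * #|S| = #|N| + ~~ b * #|S|.
Proof.
case: b => NS; rewrite ?mul1n ?mul0n ?addn0 /=.
  rewrite -[in RHS](cardsID S N) addnC; congr (_ + _); apply: eq_card => w.
    by rewrite inE andbC; case: (boolP (w \in S)) => // /NS ->.
  by rewrite !inE; case: (boolP (w \in S)) => [/NS ->|]; rewrite ?addbF.
rewrite -cardsUI (_ : N :&: S = set0) ?cards0 ?addn0.
  apply: eq_card => w; rewrite !inE.
  by case: (boolP (w \in S)) => [/NS ->|]; rewrite ?addbF ?orbF.
by apply/setP => w; rewrite !inE andbC; case: (boolP (w \in S)) => // /NS ->.
Qed.

(** [b] tells whether the toggled edges lie in [h], and [t] counts those at [u]; adding [t] on one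
    side or the other avoids truncated subtraction. *)
Lemma toggle_star_deg v S h (b : bool) u :
    symmetric h -> v \notin S -> (forall w, w \in S -> h v w = b) ->
  let t := (u \in S) + (u == v) * #|S| in
  subgraph_deg (toggle_star v S h) u + b * t = subgraph_deg h u + ~~ b * t.
Proof.
move=> h_sym vS hS /=.
pose D := if u == v then S else if u \in S then [set v] else set0.
have -> : (u \in S) + (u == v) * #|S| = #|D|.
  rewrite /D; have [->|_] := eqVneq u v; first by rewrite (negbTE vS) mul1n.
  by case: (u \in S); rewrite ?cards1 ?cards0.
rewrite -card_toggle => [|w].
  congr (_ + _); apply: eq_card => w; rewrite !inE /toggle_star /D.
  have [->|uv] := eqVneq u v; first by rewrite (negbTE vS) andbF orbF.
  by case: (u \in S); rewrite ?inE ?andbT ?andbF.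
rewrite inE /D; have [->|uv] := eqVneq u v; first exact: hS.
by case: (boolP (u \in S)) => uS; rewrite inE // => /eqP ->; rewrite h_sym hS.
Qed.

Lemma toggle_star_spanning v S h :
  spanning h -> (forall w, w \in S -> adj v w) -> spanning (toggle_star v S h).
Proof.
move=> [h_sym hG] SG; split=> u w; rewrite /toggle_star; first by rewrite h_sym orbC.
case: (boolP (h u w)) => [/hG //|_] /=.
by case/orP => /andP[/eqP -> /SG //]; rewrite adj_sym.
Qed.

(* Flipping such a path raises the degree at vertices outside [top] and       *)
(* lowers it at vertices of [top] when it leaves them, hence the degrees       *)
(* change only at its two ends.                                                *)
Definition alternating h (top : pred G) : rel G := fun u w =>
  [&& adj u w, h u w == top u & top w != top u].

(** Induction toggling the first edge, which leaves the rest of the path alternating because [x]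
    does not recur. *)
Lemma flip_alternating_path h (top : pred G) x p (l := last x p) :
    spanning h -> path (alternating h top) x p -> uniq (x :: p) ->
  exists h', [/\ spanning h',
    forall u w, h' u w != h u w ->
      [&& u \in x :: p, w \in x :: p & top u != top w] &
    forall v,
      subgraph_deg h' v + (top x && (v == x)) + (~~ top l && (v == l)) =
      subgraph_deg h v + (~~ top x && (v == x)) + (top l && (v == l))].
Proof.
rewrite {}/l; elim: p x h => [|y p IHp] x h hG.
  by exists h; split=> // [u w|v]; [rewrite eqxx | rewrite /=; case: (top x); lia].
move=> /[dup] xyp /= /andP[/and3P[xy hxy top_xy] yp] /andP[x_yp uniq_yp].
have xNy : x \notin [set y].
  by apply: contraNN x_yp; rewrite !inE => /eqP ->; rewrite eqxx.
pose h1 := toggle_star x [set y] h.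
have h1G : spanning h1 by apply: toggle_star_spanning => // w /set1P ->.
have yp1 : path (alternating h1 top) y p.
  apply: (@sub_in_path _ (predC1 x) _ (alternating h1 top)) yp.
    move=> u w ux wx; rewrite /alternating /h1 /toggle_star.
    by rewrite (negbTE ux) (negbTE wx) addbF.
  by apply/allP => u u_yp /=; apply: contraNneq x_yp => <-.
have [h' [h'G h'h1 h'deg]] := IHp y h1 h1G yp1 uniq_yp.
exists h'; split=> // [u w|v].
  have [->|/h'h1 /and3P[u_yp w_yp ->] _] := eqVneq (h' u w) (h1 u w); last first.
    by rewrite inE u_yp orbT inE w_yp orbT.
  rewrite /h1 /toggle_star; set c := _ || _.
  case: (boolP c) => [|_]; last first.
    by rewrite addbF eqxx.
  case/orP => /andP[/eqP -> /set1P ->] _; rewrite !inE !eqxx ?orbT //=.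
  by rewrite eq_sym.
have h1deg : forall w, w \in [set y] -> h x w = top x.
  by move=> w /set1P ->; apply/eqP.
have {h1deg} := toggle_star_deg v hG.1 xNy h1deg.
have := h'deg v; rewrite /= cards1 inE -/h1.
move: top_xy; clear; case: (top x); case: (top y) => //= _.
  by case: (v == x); case: (v == y); case: (top _); case: (v == _) => /=; lia.
by case: (v == x); case: (v == y); case: (top _); case: (v == _) => /=; lia.
Qed.
End Subgraphs.

(** * Targets, deficits and improvements *)

Section DegreeConstrained.
Set Implicit Arguments.
Unset Strict Implicit.

Variables (G : sgraph) (lo hi : G -> nat).
Hypothesis lo_hi : forall v, (lo v).+1 < hi v.
Implicit Types (s : pred G) (h : rel G) (u v w x y : G) (S X : {set G}).

Definition target s v := if s v then hi v else lo v.

Definition feasible s h :=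
  spanning h /\ forall v, subgraph_deg h v <= (target s v).+1.

(** Subtraction is truncated: a vertex above its target counts 0. *)
Definition deficit s h v := target s v - subgraph_deg h v.

Definition improvable s h := exists s' h',
  feasible s' h' /\ \sum_v deficit s' h' v < \sum_v deficit s h v.

Lemma improvable_pointwise s h s' h' x : spanning h' ->
    (forall v, subgraph_deg h' v <= (target s' v).+1 /\
               deficit s' h' v + (v == x) <= deficit s h v) ->
  improvable s h.
Proof.
move=> h'G s'h'; exists s', h'; split; first by split=> // v; case: (s'h' v).
rewrite (bigD1 x) //= [ltnRHS](bigD1 x) //= -addSn leq_add //.
  by have [_] := s'h' x; rewrite eqxx addn1.
by apply: leq_sum => v _; have [_] := s'h' v; apply: leq_trans; apply: leq_addr.
Qed.

Lemma exists_subset_card X k :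
  k <= #|X| -> exists S, S \subset X /\ #|S| = k.
Proof.
move=> /card_geqP[t [t_uniq <- tX]]; exists [set w in t]; split.
  by apply/subsetP => w; rewrite inE => /tX.
by rewrite cardsE; apply/card_uniqP.
Qed.

Lemma exists_subset_card_mem X y k : y \in X -> 0 < k <= #|X| ->
  exists S, [/\ S \subset X, y \in S & #|S| = k].
Proof.
case: k => // k yX /=; rewrite (cardsD1 y X) yX => /exists_subset_card[S [SX Sk]].
exists (y |: S); split; first by rewrite subUset sub1set yX (subset_trans SX) ?subD1set.
  exact: setU11.
rewrite cardsU1 Sk; case: (boolP (y \in S)) => // /(subsetP SX).
by rewrite !inE eqxx.
Qed.

(** * Exploration from a deficient vertex *)

Section Search.
Variables (s : pred G) (h : rel G) (x : G).
Hypothesis sh : feasible s h.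
Hypothesis x_deficient : subgraph_deg h x < target s x.

Definition above v := target s v < subgraph_deg h v.

Definition reached v := connect (alternating h above) x v.

Let aboveNx : above x = false.
Proof. by apply/negbTE; rewrite -leqNgt ltnW. Qed.

(** Flip a path from [x] to [u], then toggle [uw]: the changes at the end [u] cancel, [x] gains an
    edge, and [w] loses an edge it can spare or gains one within the slack. *)
Lemma improvable_same_side u w :
    reached u -> adj u w -> h u w = above u -> above w = above u ->
  improvable s h.
Proof.
move=> /connectP[p0 xp0 def_u] uw huw wu.
have [hG hT] := sh.
case/shortenP: xp0 def_u => p xp p_uniq _ def_u.
have [h1 [h1G h1h h1deg]] := flip_alternating_path hG xp p_uniq.
rewrite -def_u in h1deg.
(* A flip alters only edges between opposite sides, so not [uw]. *)
have h1uw : h1 u w = above u.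
  rewrite -huw; apply/eqP/negPn; apply/negP => /h1h.
  by rewrite wu eqxx !andbF.
have uNw : u \notin [set w].
  by apply: contraTN uw => /set1P ->; rewrite adj_irrefl.
have h1w w' : w' \in [set w] -> h1 u w' = above u by move=> /set1P ->.
apply: (@improvable_pointwise s h s (toggle_star u [set w] h1) x).
  by apply: toggle_star_spanning => // w' /set1P ->.
move=> v; move: (h1deg v) (hT v); rewrite /deficit.
have := toggle_star_deg v h1G.1 uNw h1w; rewrite /= cards1 inE aboveNx /=.
have : v == w -> above v = above u by move=> /eqP ->.
have : v == x -> subgraph_deg h v < target s v by move=> /eqP ->.
by rewrite {1}/above; clear; case: (above u) => /=;
  case: (v == w); case: (v == x); case: (v == u); lia.
Qed.

(** Stopping the flip just before [v] keeps the edges at [v] intact; toggling a star at [v] through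
    [y] then completes the path and repairs [y]. *)
Lemma flip_to_predecessor v : reached v -> v != x -> exists y h1,
  [/\ reached y, alternating h above y v, spanning h1,
      forall w, h1 v w = h v w &
      forall u, subgraph_deg h1 u + (~~ above y && (u == y)) =
                subgraph_deg h u + (u == x) + (above y && (u == y))].
Proof.
move=> /connectP[p0 xp0 def_v] vx; have [hG _] := sh.
case/shortenP: xp0 def_v => p + + _.
case/lastP: p => [|p v']; first by move=> _ _ /= def_v; rewrite def_v eqxx in vx.
rewrite rcons_path last_rcons => /andP[xp yv] + def_v; rewrite -{v'}def_v in yv *.
rewrite -rcons_cons rcons_uniq => /andP[v_xp p_uniq].
have [h1 [h1G h1h h1deg]] := flip_alternating_path hG xp p_uniq.
exists (last x p), h1; split=> // [|w|u]; first by apply/connectP; exists p.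
  by apply/eqP/negPn; apply: contraNN v_xp => /h1h/and3P[].
by have := h1deg u; rewrite aboveNx /=; lia.
Qed.

(* [v] can drop to its lower target because enough of its [h]-edges lead to   *)
(* reached vertices above their target, and each of these can spare an edge.  *)
Lemma improvable_lower v :
    reached v -> above v = false -> s v ->
    #|[set w | adj v w && ~~ (reached w && above w)]| <= (lo v).+1 ->
  improvable s h.
Proof.
move=> rv av sv few; have [hG hT] := sh.
pose X := [set w | h v w & reached w && above w].
have cardX : subgraph_deg h v <= #|X| + (lo v).+1.
  rewrite /subgraph_deg -(cardsID X) leq_add //.
    by apply/subset_leq_card/subsetIr.
  apply: leq_trans few; apply/subset_leq_card/subsetP => w.
  by rewrite !inE => /andP[/[swap] hvw]; rewrite hvw (hG.2 _ _ hvw).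
pose s' := [pred u | (u != v) && s u].
have s'E u : target s' u = if u == v then lo v else target s u.
  by rewrite /target /=; have [->|] := eqVneq u v.
have tv : target s v = hi v by rewrite /target sv.
have vNX S : S \subset X -> v \notin S.
  by move=> /subsetP SX; apply/negP => /SX; rewrite inE av !andbF.
have aX S u : S \subset X -> u \in S -> target s u < subgraph_deg h u.
  by move=> /subsetP SX /SX; rewrite inE => /and3P[].
have hX S w : S \subset X -> w \in S -> h v w.
  by move=> /subsetP SX /SX; rewrite inE => /andP[].
have lov := lo_hi v.
have vle : subgraph_deg h v <= hi v by rewrite -tv leqNgt; apply/negbT.
(* If [v] is itself deficient, switching it lowers its own deficit; otherwise a flip must help
   [x]. *)
have [v_def|v_full] := ltnP (subgraph_deg h v) (hi v).
  have [|S [SX Sk]] := @exists_subset_card X (subgraph_deg h v - (lo v).+1).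
    by rewrite leq_subLR addnC.
  apply: (@improvable_pointwise s h s' (toggle_star v S h) v).
    by apply: toggle_star_spanning => // w /(hX _ _ SX)/(hG.2).
  move=> u; rewrite /deficit s'E.
  have := @toggle_star_deg _ v S h true u hG.1 (vNX _ SX) (fun w => hX S w SX).
  have := aX S u SX; have := hT u; rewrite Sk.
  case: (eqVneq u v) => [->|_]; last by clear; case: (u \in S); lia.
  by rewrite (negbTE (vNX _ SX)) tv; move: lov v_def; clear; lia.
have vx : v != x.
  by apply/eqP => vx; move: x_deficient; rewrite -vx tv ltnNge v_full.
have [y [h1 [ry yv h1G h1v h1deg]]] := flip_to_predecessor rv vx.
have ay : above y by case/and3P: yv => _ _; rewrite av; case: above.
have yX : y \in X.
  by rewrite inE ry ay !andbT hG.1; case/and3P: yv => _ /eqP ->.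
(* Losing this many edges takes [v] from [hi v] to [(lo v).+1]; by [lo_hi] the number is positive,
   leaving room for [y]. *)
have [|S [SX yS Sk]] := @exists_subset_card_mem X y (hi v - (lo v).+1) yX.
  by lia.
apply: (@improvable_pointwise s h s' (toggle_star v S h1) x).
  by apply: toggle_star_spanning => // w /(hX _ _ SX)/(hG.2).
move=> u; rewrite /deficit s'E.
have h1S w : w \in S -> h1 v w by rewrite h1v; apply: hX.
have := @toggle_star_deg _ v S h1 true u h1G.1 (vNX _ SX) h1S.
have := aX S u SX; have := hT u; have := h1deg u; rewrite Sk ay.
have : u == y -> u \in S by move=> /eqP ->.
have : u == x -> subgraph_deg h u < target s u by move=> /eqP ->.
case: (eqVneq u v) => [->|_]; last first.
  by clear; case: (u == x); case: (u == y); case: (u \in S) => /=; lia.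
rewrite (negbTE vx) (negbTE (vNX _ SX)) tv; move: lov v_full vle; clear.
by case: (v == y) => /=; lia.
Qed.

(* Dually, [v] can rise to its upper target because reached vertices not      *)
(* above their target can absorb an edge each.                                 *)
Lemma improvable_raise v :
    reached v -> above v -> s v = false ->
    (forall w, h v w -> reached w && ~~ above w) ->
    hi v <= #|[set w | adj v w && (reached w && ~~ above w)]| ->
  improvable s h.
Proof.
move=> rv av sv hv many; have [hG hT] := sh.
pose X := [set w | [&& adj v w, ~~ h v w & reached w && ~~ above w]].
have cardX : hi v <= #|X| + subgraph_deg h v.
  apply: leq_trans many _; rewrite -(cardsID [set w | h v w]) addnC leq_add //.
    apply/subset_leq_card/subsetP => w; rewrite !inE.
    by case/and3P => -> -> /andP[-> ->].
  by apply/subset_leq_card/subsetIr.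
pose s' := [pred u | (u == v) || s u].
have s'E u : target s' u = if u == v then hi v else target s u.
  by rewrite /target /=; have [->|] := eqVneq u v.
have tv : target s v = lo v by rewrite /target sv.
have vx : v != x by apply: contraTneq av => ->; rewrite aboveNx.
have degv : subgraph_deg h v = (lo v).+1.
  by apply/eqP; rewrite eqn_leq -{1}tv hT -tv.
have [y [h1 [ry yv h1G h1v h1deg]]] := flip_to_predecessor rv vx.
have ay : above y = false by case/and3P: yv => _ _; rewrite av; case: above.
have yX : y \in X.
  by rewrite inE ry ay adj_sym hG.1; case/and3P: yv => -> /eqP ->; rewrite ay.
have lov := lo_hi v.
have [|S [/subsetP SX yS Sk]] := @exists_subset_card_mem X y (hi v - (lo v).+1) yX.
  by lia.
have vNS : v \notin S by apply/negP => /SX; rewrite inE av !andbF.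
have h1S w : w \in S -> h1 v w = false.
  by rewrite h1v => /SX; rewrite inE => /and3P[_ /negbTE].
apply: (@improvable_pointwise s h s' (toggle_star v S h1) x).
  by apply: toggle_star_spanning => // w /SX; rewrite inE => /andP[].
move=> u; rewrite /deficit s'E.
have := @toggle_star_deg _ v S h1 false u h1G.1 vNS h1S.
have : u \in S -> subgraph_deg h u <= target s u.
  by move=> /SX; rewrite inE leqNgt => /and4P[].
have := hT u; have := h1deg u; rewrite Sk ay.
have : u == y -> u \in S by move=> /eqP ->.
have : u == x -> subgraph_deg h u < target s u by move=> /eqP ->.
case: (eqVneq u v) => [->|_]; last first.
  by clear; case: (u == x); case: (u == y); case: (u \in S) => /=; lia.
rewrite (negbTE vx) (negbTE vNS) tv degv; move: lov; clear.
by case: (v == y) => /=; lia.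
Qed.

End Search.

(** * Counting edges between the two sides *)

Hypothesis lo_half : forall v, 2 * lo v <= degree v.
Hypothesis hi_half : forall v, degree v <= 2 * (hi v).+1.
Hypothesis hi_degree : forall v, 2 * hi v <= degree v + lo v + 2.
Hypothesis hi_lo : forall v, hi v <= 2 * lo v + 3.

Lemma card_sum_pred (P Q : pred G) :
  #|[set w | P w && Q w]| = \sum_(w | Q w) P w.
Proof.
rewrite -sum1dep_card big_mkcond [RHS]big_mkcond; apply: eq_bigr => w _.
by case: (P w); case: (Q w).
Qed.

Lemma subgraph_degE h (Q : pred G) v :
  subgraph_deg h v = \sum_(w | Q w) h v w + \sum_(w | ~~ Q w) h v w.
Proof.
transitivity (\sum_w h v w); last by rewrite (bigID Q).
by rewrite -(card_sum_pred (h v) predT); apply: eq_card => w; rewrite !inE andbT.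
Qed.

(* Counting at [B] shows that [h] contains at least half of the edges between *)
(* [A] and [B]; counting at [A], where [h] falls short of the targets, shows  *)
(* that it contains less than half of them.                                    *)
Lemma no_deficient_separation s h (A B : {set G}) x :
    spanning h -> x \in A -> subgraph_deg h x < target s x ->
    (forall v, v \in A -> subgraph_deg h v <= target s v) ->
    (forall v, v \in B -> subgraph_deg h v = (target s v).+1) ->
    (forall v w, v \in A -> adj v w -> w \notin B -> h v w) ->
    (forall v w, v \in B -> h v w -> w \in A) ->
    (forall v, v \in A ->
       2 * target s v + \sum_(w in B) adj v w <= 2 * degree v) ->
    (forall v, v \in B -> \sum_(w in A) adj v w <= 2 * (target s v).+1) ->
  False.
Proof.
move=> [h_sym hG] xA x_def Ale Beq hA hB goodA goodB.
pose E := \sum_(v in A) \sum_(w in B) adj v w.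
pose EH := \sum_(v in A) \sum_(w in B) h v w.
have degA : \sum_(v in A) subgraph_deg h v + E = \sum_(v in A) degree v + EH.
  rewrite -!big_split /=; apply: eq_bigr => v vA.
  rewrite -[degree v]/(subgraph_deg (@adj G) v) (subgraph_degE h (mem B)).
  rewrite (subgraph_degE (@adj G) (mem B)) addnAC [RHS]addnAC.
  congr (_ + _); first exact: addnC.
  by apply: eq_bigr => w wB; congr nat_of_bool; apply/idP/idP => [/hG|vw] //; apply: hA.
have degB : EH = \sum_(v in B) (target s v).+1.
  rewrite /EH exchange_big; apply: eq_bigr => w wB /=.
  rewrite -Beq // (subgraph_degE h (mem A)) [X in _ + X]big1 ?addn0 => [|v vA].
    by apply: eq_bigr => v _; rewrite h_sym.
  by case: (boolP (h w v)) => // /(hB _ _ wB) vA'; rewrite inE vA' in vA.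
have leE : E <= 2 * EH.
  rewrite degB /E exchange_big big_distrr leq_sum // => w wB /=.
  by apply: leq_trans (goodB w wB); apply: leq_sum => v _; rewrite adj_sym.
have leA : 2 * \sum_(v in A) target s v + E <= 2 * \sum_(v in A) degree v.
  by rewrite !big_distrr /= -big_split leq_sum.
have ltA : \sum_(v in A) subgraph_deg h v < \sum_(v in A) target s v.
  rewrite (bigD1 x) //= [ltnRHS](bigD1 x) //= -addSn leq_add // leq_sum // => v.
  by case/andP => /Ale.
by move: degA leE leA ltA; clear; lia.
Qed.

Lemma deficient_improvable s h x :
  feasible s h -> subgraph_deg h x < target s x -> improvable s h.
Proof.
move=> sh x_def; have [hG hT] := sh.
pose A := [set v | reached s h x v && ~~ above s h v].
pose B := [set v | reached s h x v && above s h v].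
have [/existsP[u /existsP[w /and4P[ru uw /eqP huw /eqP wu]]]|same] :=
  boolP [exists u, exists w, [&& reached s h x u, adj u w,
                                 h u w == above s h u & above s h w == above s h u]].
  exact: (improvable_same_side sh x_def ru uw huw wu).
(* As no same-side improvement exists, such an edge always crosses sides and so extends the
   exploration. *)
have step u w : reached s h x u -> adj u w -> h u w = above s h u ->
    reached s h x w /\ above s h w = ~~ above s h u.
  move=> ru uw huw; have wu : above s h w != above s h u.
    apply: contraNN same => wu; apply/existsP; exists u; apply/existsP; exists w.
    by rewrite ru uw huw eqxx.
  split; last by move: wu; case: above; case: above.
  by apply: connect_trans ru (connect1 _); rewrite /alternating uw huw eqxx.
have hA v w : v \in A -> adj v w -> w \notin B -> h v w.
  rewrite !inE => /andP[rv av] vw; apply: contraNT => hvw.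
  by have [|-> ->] := step _ _ rv vw; rewrite ?(negbTE hvw) (negbTE av).
have hB v w : v \in B -> h v w -> w \in A.
  rewrite !inE => /andP[rv av] hvw.
  by have [|-> ->] := step _ _ rv (hG.2 _ _ hvw); rewrite ?hvw av.
have [/existsP[v /and3P[]]|noA] := boolP [exists v, [&& v \in A, s v &
    #|[set w | adj v w && ~~ (reached s h x w && above s h w)]| <= (lo v).+1]].
  by rewrite inE => /andP[rv /negbTE av]; apply: (improvable_lower sh x_def rv av).
have [/existsP[v /and3P[]]|noB] := boolP [exists v, [&& v \in B, ~~ s v &
    hi v <= #|[set w | adj v w && (reached s h x w && ~~ above s h w)]|]].
  move=> vB /negbTE sv; have /andP[rv av] : reached s h x v && above s h v.
    by move: vB; rewrite inE.
  apply: (improvable_raise sh x_def rv av sv) => w /(hB _ _ vB).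
  by rewrite inE.
exfalso; apply: (@no_deficient_separation s h A B x) => //.
- by rewrite inE /reached connect0 -leqNgt ltnW.
- by move=> v; rewrite inE -leqNgt => /andP[].
- by move=> v; rewrite inE => /andP[_ av]; apply/eqP; rewrite eqn_leq hT.
(* Target [lo] is settled by [lo_half]; for [hi], over [(lo v).+1] neighbors lie outside [B] and
   [hi_degree] applies. *)
- move=> v vA; have := subgraph_degE (@adj G) (mem B) v.
  rewrite -[subgraph_deg _ _]/(degree v) -!card_sum_pred /target.
  case: ifPn => sv; last by have := lo_half v; move: #|_| #|_|; clear; lia.
  move: noA; rewrite negb_exists => /forallP/(_ v); rewrite vA sv /= -ltnNge.
  have -> : [set w | adj v w && ~~ (reached s h x w && above s h w)] =
            [set w | adj v w && (w \notin B)] by apply/setP => w; rewrite !inE.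
  by have := hi_degree v; move: #|_| #|_|; clear; lia.
(* Target [hi] is settled by [hi_half]; for [lo], fewer than [hi v] neighbors lie in [A] and [hi_lo]
   applies. *)
move=> v vB; have := subgraph_degE (@adj G) (mem A) v.
rewrite -[subgraph_deg _ _]/(degree v) -!card_sum_pred /target.
case: ifPn => sv; first by have := hi_half v; move: #|_| #|_|; clear; lia.
move: noB; rewrite negb_exists => /forallP/(_ v); rewrite vB sv /= -ltnNge.
have -> : [set w | adj v w && (reached s h x w && ~~ above s h w)] =
          [set w | adj v w && (w \in A)] by apply/setP => w; rewrite !inE.
by have := hi_lo v; move: #|_| #|_|; clear; lia.
Qed.

(** Start from the empty subgraph with all targets [lo] and improve until no deficit is left. *)
Lemma degree_constrained_subgraph : exists h, spanning h /\
  forall v, subgraph_deg h v \in [:: lo v; (lo v).+1; hi v; (hi v).+1].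
Proof.
suff complete n s h : feasible s h -> \sum_v deficit s h v < n -> exists h',
    spanning h' /\
    forall v, subgraph_deg h' v \in [:: lo v; (lo v).+1; hi v; (hi v).+1].
  apply: (complete _ pred0 [rel u v : G | false] _ (ltnSn _)).
  by split=> // v; rewrite [subgraph_deg _ _]eq_card0 // => w; rewrite inE.
elim: n s h => // n IHn s h sh; rewrite ltnS => le_n.
have [x x_def|full] := pickP (fun x => subgraph_deg h x < target s x).
  have [s' [h' [sh' lt']]] := deficient_improvable sh x_def.
  exact: (IHn s' h' sh' (leq_trans lt' le_n)).
case: sh => hG hT; exists h; split=> // v; move: (full v) (hT v).
rewrite /target !inE; case: (s v); clear; lia.
Qed.

End DegreeConstrained.

(** * From subgraphs to edge weightings *)

Section Weighting.
Set Implicit Arguments.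
Unset Strict Implicit.

Variables (G : sgraph) (h : rel G).
Hypothesis hG : spanning h.

Definition subgraph_weight (e : {set G}) : nat :=
  1 + [exists p : G * G, h p.1 p.2 && (e == [set p.1; p.2])].

Lemma subgraph_weight_edge u v : adj u v -> subgraph_weight [set u; v] = 1 + h u v.
Proof.
move=> uv; congr (1 + nat_of_bool _); apply/existsP/idP => [[[a b]]|huv]; last first.
  by exists (u, v); rewrite huv eqxx.
have [h_sym _] := hG; rewrite /= => /andP[hab /eqP uv_ab].
have /set2P[ua|ub] : u \in [set a; b] by rewrite -uv_ab set21.
  have /set2P[va|->] : v \in [set a; b] by rewrite -uv_ab set22.
    by rewrite ua va adj_irrefl in uv.
  by rewrite ua.
have /set2P[->|vb] : v \in [set a; b] by rewrite -uv_ab set22.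
  by rewrite ub h_sym.
by rewrite ub vb adj_irrefl in uv.
Qed.

Lemma weight_coloring_subgraph u :
  weight_coloring subgraph_weight u = degree u + subgraph_deg h u.
Proof.
pose N := [set v | adj u v].
have edge_at e : (e \in edges G) && (u \in e) = (e \in [set [set u; v] | v in N]).
  apply/andP/imsetP => [[/imsetP[[a b]]]|[v]]; rewrite inE => /= uv ->.
    rewrite /N; case/set2P => ->; first by exists b; rewrite ?inE.
    exists a; last exact: setUC.
    by rewrite inE adj_sym.
  by rewrite set21; split=> //; apply/imsetP; exists (u, v); rewrite ?inE.
rewrite /weight_coloring (eq_bigl _ _ edge_at) big_imset /=; last first.
  move=> v v'; rewrite !inE => uv uv' vv'.
  have /set2P[vu|//] : v \in [set u; v'] by rewrite -vv' set22.
  by rewrite vu adj_irrefl in uv.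
transitivity (\sum_(v in N) (1 + h u v)).
  by apply: eq_bigr => v; rewrite inE => /subgraph_weight_edge.
rewrite big_split /= sum1_card; congr (_ + _).
rewrite -card_sum_pred; apply: eq_card => v; rewrite !inE.
by case: (boolP (h u v)) => // /hG.2 ->.
Qed.

End Weighting.

Theorem theorem2p5 (G : sgraph)
  (noK2 : forall x : G, ~ graph_iso (induced (component x)) (complete 2))
  (hdeg : 8 * chromatic_number G <= min_degree G) :
  exists w : {set G} -> nat,
    edge_weighting 2 w /\ vertex_coloring_weighting w.
Proof.
move: hdeg; rewrite /chromatic_number; case: ex_minnP => k /existsP[f f_proper] _.
move=> hdeg; have degk (v : G) : 8 * k <= degree v.
  apply: leq_trans hdeg _; rewrite /min_degree.
  elim: (index_enum G) (mem_index_enum v) => // u t IHt.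
  by rewrite inE big_cons geq_min => /predU1P[->|/IHt ->]; rewrite ?leqnn ?orbT.
pose m := 2 * k.
(* Lowering half the degree by [r v] makes [lo v + degree v] congruent to [2 * f v]; [2 * (k - f v)]
   stands for [- 2 * f v] modulo [m]. *)
pose r (v : G) := ((degree v)./2 + degree v + 2 * (k - f v)) %% m.
pose lo (v : G) := (degree v)./2 - r v.
have r_lt (v : G) : r v < m by rewrite ltn_mod; have := ltn_ord (f v); lia.
have loE (v : G) : exists q, lo v + degree v = 2 * f v + q * m.
  have := divn_eq ((degree v)./2 + degree v + 2 * (k - f v)) m.
  rewrite -/(r v) /lo; have := degk v; have := ltn_ord (f v); have := r_lt v.
  rewrite /m; move: (_ %/ _) => [|q]; first by lia.
  by move=> rv fv dv divE; exists q; move: divE; rewrite mulSn; lia.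
have [h [hG hdegh]] : exists h : rel G, spanning h /\ forall v,
    subgraph_deg h v \in [:: lo v; (lo v).+1; lo v + m; (lo v + m).+1].
  (* The bound [8 * k] serves [hi_degree], as [lo v] may reach half the degree, and [hi_lo], as
     [r v] may reach [m - 1]. *)
  apply: degree_constrained_subgraph => v; have := degk v; have := ltn_ord (f v);
    have := r_lt v; rewrite /lo /m; lia.
exists (subgraph_weight h); split=> [e _|u v uv].
  by rewrite /subgraph_weight; case: [exists _, _].
(* The residue is [2 * f t] or [2 * f t + 1], both below [m], so halving it recovers the color. *)
have cE t : f t = (weight_coloring (subgraph_weight h) t %% m)./2 :> nat.
  have [q lo_q] := loE t; have ft := ltn_ord (f t).
  have [b [q' ->]] : exists (b : bool) q',
      weight_coloring (subgraph_weight h) t = q' * m + (b + (f t).*2).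
    rewrite weight_coloring_subgraph //; have := hdegh t; rewrite !inE.
    case/or4P => /eqP ->; [exists false, q | exists true, q
                          | exists false, q.+1 | exists true, q.+1];
      rewrite ?mulSn; lia.
  by rewrite modnMDl modn_small ?half_bit_double //; case: b; rewrite /m; lia.
move=> uv_eq; move/forallP/(_ u)/forallP/(_ v): f_proper.
by rewrite uv /= => /eqP; apply; apply: val_inj; rewrite /= !cE uv_eq.
Qed.
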